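(* Let $\mathsf{Grp}$ be the category of groups and group homomorphisms, and let $\mathsf{Grp}^{\leftrightarrow}$ be the subcategory of all groups and their isomorphisms. For every group $G$ the following equalities of sets of subgroups of $G$ hold: $$\{H\le G \mid H \text{ characteristic in } G\}=\{\mathrm{Im}(\iota_G)\mid \iota\in \mathrm{Counital}(\mathsf{Grp}^{\leftrightarrow},\mathsf{Grp})\},$$ $$\{H\le G \mid H \text{ fully invariant in } G\}=\{\mathrm{Im}(\iota_G)\mid \iota\in \mathrm{Counital}(\mathsf{Grp},\mathsf{Grp})\}.$$
   Context: A subgroup $H$ of $G$ is characteristic if $\varphi(H)=H$ for every automorphism $\varphi:G\to G$; it is fully invariant if $\psi(H)\le H$ for every homomorphism $\psi:G\to G$. Let $\mathsf{A}$ be a category and $\mathsf{B}$ a subcategory with inclusion functor $\mathcal{I}:\mathsf{B}\to\mathsf{A}$. A counital is a natural transformation $\iota:\mathcal{C}\Rightarrow\mathcal{I}$ for some functor $\mathcal{C}:\mathsf{B}\to\mathsf{A}$. The class of all such counitals (over all functors $\mathcal{C}$) is denoted $\mathrm{Counital}(\mathsf{B},\mathsf{A})$. For an object $X$ of $\mathsf{B}$, the $X$-component of $\iota$ is the morphism $\iota_X:\mathcal{C}(X)\to\mathcal{I}(X)$ in $\mathsf{A}$. *)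

(* Defs.v *)
From HB Require Import structures.
From mathcomp Require Import all_boot.
From mathcomp Require Import boolp classical_sets.

Set Implicit Arguments.
Unset Strict Implicit.
Unset Printing Implicit Defensive.

Local Open Scope classical_set_scope.

Record category := Category {
  ob :> Type;
  hom : ob -> ob -> Type;
  idm : forall X : ob, hom X X;
  compm : forall X Y Z : ob, hom Y Z -> hom X Y -> hom X Z;
  compm1 : forall (X Y : ob) (f : hom X Y), compm f (idm X) = f;
  comp1m : forall (X Y : ob) (f : hom X Y), compm (idm Y) f = f;
  compmA : forall (W X Y Z : ob) (h : hom Y Z) (g : hom X Y) (f : hom W X),
    compm h (compm g f) = compm (compm h g) f
}.

Record functor (A B : category) := Functor {
  fob :> A -> B;
  fmap : forall X Y : A, hom X Y -> hom (fob X) (fob Y);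
  fmap_id : forall X : A, fmap (idm X) = idm (fob X);
  fmap_comp : forall (X Y Z : A) (g : hom Y Z) (f : hom X Y),
    fmap (compm g f) = compm (fmap g) (fmap f)
}.

Record nat_trans (A B : category) (F G : functor A B) := NatTrans {
  component :> forall X : A, hom (F X) (G X);
  naturality : forall (X Y : A) (f : hom X Y),
    compm (component Y) (fmap F f) = compm (fmap G f) (component X)
}.

(* [sub_hom] matters only on morphisms between objects satisfying [sub_ob]. *)
Record subcategory (A : category) := Subcategory {
  sub_ob : A -> Prop;
  sub_hom : forall X Y : A, hom X Y -> Prop;
  sub_id : forall X : A, sub_ob X -> sub_hom (idm X);
  sub_comp : forall (X Y Z : A) (g : hom Y Z) (f : hom X Y),
    sub_ob X -> sub_ob Y -> sub_ob Z ->
    sub_hom g -> sub_hom f -> sub_hom (compm g f)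
}.

Section SubcategoryAsCategory.
Variables (A : category) (B : subcategory A).

Definition subcat_ob := {X : A | sub_ob B X}.

Definition subcat_hom (X Y : subcat_ob) :=
  {f : hom (sval X) (sval Y) | sub_hom B f}.

Definition subcat_id (X : subcat_ob) : subcat_hom X X :=
  exist _ (idm (sval X)) (sub_id (svalP X)).

Definition subcat_comp (X Y Z : subcat_ob)
    (g : subcat_hom Y Z) (f : subcat_hom X Y) : subcat_hom X Z :=
  exist _ (compm (sval g) (sval f))
    (sub_comp (svalP X) (svalP Y) (svalP Z) (svalP g) (svalP f)).

Lemma subcat_comp1 X Y (f : subcat_hom X Y) : subcat_comp f (subcat_id X) = f.
Proof. by case: f => f fB; apply: eq_exist; rewrite compm1. Qed.

Lemma subcat_1comp X Y (f : subcat_hom X Y) : subcat_comp (subcat_id Y) f = f.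
Proof. by case: f => f fB; apply: eq_exist; rewrite comp1m. Qed.

Lemma subcat_compA W X Y Z (h : subcat_hom Y Z) (g : subcat_hom X Y)
    (f : subcat_hom W X) :
  subcat_comp h (subcat_comp g f) = subcat_comp (subcat_comp h g) f.
Proof. by apply: eq_exist; rewrite compmA. Qed.

Definition subcat : category :=
  Category subcat_comp1 subcat_1comp subcat_compA.

Definition inclusion : functor subcat A :=
  @Functor subcat A (fun X => sval X) (fun X Y f => sval f)
    (fun _ => erefl) (fun _ _ _ _ _ => erefl).

End SubcategoryAsCategory.

Definition whole (A : category) : subcategory A :=
  @Subcategory A (fun=> True) (fun _ _ _ => True)
    (fun _ _ => I) (fun _ _ _ _ _ _ _ _ _ _ => I).

Record counital (A : category) (B : subcategory A) := Counital {
  counital_functor : functor (subcat B) A;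
  counital_trans :> nat_trans counital_functor (inclusion B)
}.

Section GroupCategory.

Definition grp_hom (G H : groupType) : Type := {multiplicative G -> H}.

Definition grp_id (G : groupType) : grp_hom G G := idfun.

Definition grp_comp (G H K : groupType) (g : grp_hom H K) (f : grp_hom G H) :
  grp_hom G K := g \o f.

Lemma grp_homP (G H : groupType) (f g : grp_hom G H) :
  (f : G -> H) = g -> f = g.
Proof.
case: f g => [f [[fM]]] [g [[gM]]] /= E; subst g.
by rewrite (Prop_irrelevance fM gM).
Qed.

Lemma grp_comp1 (G H : groupType) (f : grp_hom G H) :
  grp_comp f (grp_id G) = f.
Proof. exact: grp_homP. Qed.

Lemma grp_1comp (G H : groupType) (f : grp_hom G H) :
  grp_comp (grp_id H) f = f.
Proof. exact: grp_homP. Qed.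

Lemma grp_compA (G H K L : groupType)
    (h : grp_hom K L) (g : grp_hom H K) (f : grp_hom G H) :
  grp_comp h (grp_comp g f) = grp_comp (grp_comp h g) f.
Proof. exact: grp_homP. Qed.

(* A [groupType] also carries a choice operator; morphisms ignore it, and
   classically every group can be given one. *)
Definition Grp : category := Category grp_comp1 grp_1comp grp_compA.

Definition is_grp_iso (G H : Grp) (f : hom G H) : Prop :=
  bijective (f : grp_hom G H).

Lemma is_grp_iso_id (G : Grp) : True -> is_grp_iso (idm G).
Proof. by move=> _; exists id. Qed.

Lemma is_grp_iso_comp (G H K : Grp) (g : hom H K) (f : hom G H) :
  True -> True -> True ->
  is_grp_iso g -> is_grp_iso f -> is_grp_iso (compm g f).
Proof. by move=> _ _ _; exact: bij_comp. Qed.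

Definition Grp_iso : subcategory Grp :=
  @Subcategory Grp (fun=> True) is_grp_iso is_grp_iso_id is_grp_iso_comp.

End GroupCategory.

Section Subgroups.
Variable G : groupType.
Implicit Type H : set G.

Definition subgroup H : Prop := group_closed [in H].

Definition characteristic H : Prop :=
  forall phi : {multiplicative G -> G}, bijective phi -> phi @` H = H.

Definition fully_invariant H : Prop :=
  forall psi : {multiplicative G -> G}, psi @` H `<=` H.

End Subgroups.

Definition Im (G H : Grp) (f : hom G H) : set (H : groupType) :=
  range (f : grp_hom G H).

(* [G] as an object of [Grp_iso], resp. of [whole Grp]: both contain all
   groups, so the membership proof is trivial. *)
Definition Grp_iso_ob (G : groupType) : subcat Grp_iso := exist _ (G : Grp) I.
Definition Grp_ob (G : groupType) : subcat (whole Grp) := exist _ (G : Grp) I.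

(* Main.v *)
Require Import Defs.
From HB Require Import structures.
From mathcomp Require Import all_boot.
From mathcomp Require Import boolp classical_sets.

Set Implicit Arguments.
Unset Strict Implicit.
Unset Printing Implicit Defensive.

(** Both equalities are instances of one fact about an arbitrary subcategory B
of Grp and an object G of B: the images of the components at G of counitals are
exactly the subgroups H of G with f(H) <= H for every endomorphism f of G in B.
Naturality at f gives the invariance of an image.  Conversely, let C(X) be the
subgroup of X generated by all f(H), for f : G -> X in B: composition makes C
functorial, the inclusions C(X) <= X are natural, and C(G) = H by invariance
(and because the identity of G is in B). *)

Local Open Scope classical_set_scope.
Local Open Scope group_scope.

(** Lets later arguments work with the set [K] itself instead of boolean membership in [[in K]]. *)
Lemma subgroupP (G : groupType) (K : set G) :
  subgroup K <-> K 1 /\ (forall x y, K x -> K y -> K (x / y)).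
Proof.
split=> -[K1 KF]; split; rewrite ?inE // in K1 *.
  by move=> x y Kx Ky; have := KF x y; rewrite !inE; apply.
by move=> x y; rewrite !inE; exact: KF.
Qed.

(* [gmulf1] and [gmulfF] require a [UMagmaMorphism], which the library does not
   infer from [Multiplicative] even between groups. *)
Lemma multiplicative1 (G H : groupType) (f : {multiplicative G -> H}) : f 1 = 1.
Proof. by apply: (mulIg (f 1)); rewrite -gmulfM !mul1g. Qed.

Lemma multiplicativeF (G H : groupType) (f : {multiplicative G -> H}) :
  {morph f : x y / x / y}.
(* Writing f(x) as f(x / y) * f(y) leaves f(y) to cancel. *)
Proof. by move=> x y; rewrite -[x in RHS](divgK y) [in RHS]gmulfM mulgK. Qed.

Lemma subgroup_range (G H : groupType) (f : {multiplicative G -> H}) :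
  subgroup (range f).
Proof.
apply/subgroupP; split; first by exists 1 => //; exact: multiplicative1.
move=> _ _ [x _ <-] [y _ <-]; exists (x / y) => //; exact: multiplicativeF.
Qed.

Lemma subgroup_preimage (G H : groupType) (f : {multiplicative G -> H})
    (K : set H) : subgroup K -> subgroup (f @^-1` K).
Proof.
move=> /subgroupP[K1 KF]; apply/subgroupP; split.
  by rewrite /= multiplicative1.
by move=> x y Kx Ky; rewrite /= multiplicativeF; exact: KF.
Qed.

(* The proof [sK] is a parameter so that instance inference can find it. *)
Definition subgroup_type (G : groupType) (K : set G) (sK : subgroup K) :=
  {x : G | x \in K}.

Section SubgroupType.
Variables (G : groupType) (K : set G) (sK : subgroup K).
HB.instance Definition _ := Choice.on (subgroup_type sK).
HB.instance Definition _ := SubChoice.on (subgroup_type sK).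
HB.instance Definition _ :=
  SubChoice_isSubGroup.Build G [in K] (subgroup_type sK) sK.
End SubgroupType.

Section SubgroupMorphism.
Variables (G H : groupType) (K : set G) (L : set H).
Variables (sK : subgroup K) (sL : subgroup L).
Variables (f : {multiplicative G -> H}) (fKL : K `<=` f @^-1` L).

Definition subgroup_map (x : subgroup_type sK) : subgroup_type sL :=
  exist _ (f (val x)) (mem_set (fKL (set_mem (valP x)))).

Lemma subgroup_mapM : {morph subgroup_map : x y / x * y}.
Proof.
move=> x y; apply: val_inj; rewrite valM /= -gmulfM.
by congr (f _); exact: valM.
Qed.

HB.instance Definition _ :=
  isMultiplicative.Build _ _ subgroup_map subgroup_mapM.
End SubgroupMorphism.

Section Counital.
Variable B : subcategory Grp.

Definition morph_of {X Y : subcat B} (f : hom X Y) :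
  {multiplicative (sval X : groupType) -> (sval Y : groupType)} := sval f.

Definition invariant (G : subcat B) (H : set (sval G : groupType)) :=
  forall f : hom G G, morph_of f @` H `<=` H.

Lemma Im_counital_invariant (iota : counital B) (G : subcat B) :
  invariant (Im (iota G)).
Proof.
move=> f _ [_ [x _ <-] <-].
(* The naturality square at [x] shows that the image of [x] under C(f) is the required preimage. *)
have /(congr1 (fun h : grp_hom _ _ => h x)) /= := naturality iota f.
by move=> <-; eexists.
Qed.

Variables (G : subcat B) (H : set (sval G : groupType)).

(** An intersection of subgroups rather than a set of words: membership is then used by choosing a
    suitable [K]. *)
Definition generated (X : subcat B) : set (sval X : groupType) :=
  [set x | forall K : set (sval X : groupType), subgroup K ->
    (forall f : hom G X, morph_of f @` H `<=` K) -> K x].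

Arguments generated : clear implicits.

Lemma subgroup_generated X : subgroup (generated X).
Proof.
apply/subgroupP; split=> [K /subgroupP[] // |x y Gx Gy K sK HK].
have /subgroupP[_ KF] := sK.
by apply: KF; [exact: Gx | exact: Gy].
Qed.

(** If [K] contains every image of [H] in Y, its preimage under [f] is a subgroup containing every
    image of [H] in X, because composing with [f] stays in [B]. *)
Lemma generated_map X Y (f : hom X Y) :
  generated X `<=` morph_of f @^-1` generated Y.
Proof.
move=> x Gx K sK HK; apply: (Gx (morph_of f @^-1` K)).
  exact: subgroup_preimage.
by move=> g _ [h Hh <-]; apply: (HK (compm f g)); exists h.
Qed.

Definition generated_ob (X : subcat B) : Grp :=
  subgroup_type (subgroup_generated X) : groupType.

Definition generated_hom (X Y : subcat B) (f : hom X Y) :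
    hom (generated_ob X) (generated_ob Y) :=
  subgroup_map (sK := subgroup_generated X) (subgroup_generated Y)
    (generated_map f) : {multiplicative _ -> _}.

(** Maps into a subgroup agree once their underlying values do. *)
Lemma generated_hom_id X : generated_hom (idm X) = idm (generated_ob X).
Proof. by apply: grp_homP; apply/funext => x; exact: val_inj. Qed.

Lemma generated_hom_comp X Y Z (g : hom Y Z) (f : hom X Y) :
  generated_hom (compm g f) = compm (generated_hom g) (generated_hom f).
Proof. by apply: grp_homP; apply/funext => x; exact: val_inj. Qed.

Definition generated_functor : functor (subcat B) Grp :=
  Functor generated_hom_id generated_hom_comp.

Definition generated_incl (X : subcat B) :
    hom (generated_functor X) (inclusion B X) :=
  (val : subgroup_type (subgroup_generated X) -> _) :
    {multiplicative _ -> _}.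

Lemma generated_incl_natural X Y (f : hom X Y) :
  compm (generated_incl Y) (fmap generated_functor f)
    = compm (fmap (inclusion B) f) (generated_incl X).
Proof. exact: grp_homP. Qed.

Definition generated_counital : counital B :=
  Counital (NatTrans generated_incl_natural).

Lemma Im_generated_counital :
  subgroup H -> invariant H -> H = Im (generated_counital G).
Proof.
move=> sH iH; apply/seteqP; split=> [h Hh|_ [x _ <-]].
  have Gh : generated G h.
    (* The identity makes [H] itself one of the generating images. *)
    by move=> K _ HK; apply: (HK (idm G)); exists h.
  by exists (exist _ h (mem_set Gh)).
(* By invariance, [H] is one of the subgroups [K] being intersected. *)
exact: (set_mem (valP x) H sH iH).
Qed.

End Counital.

Lemma Im_counitalP (B : subcategory Grp) (G : subcat B)
    (H : set (sval G : groupType)) :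
  subgroup H /\ @invariant B G H <->
  exists iota : counital B, H = Im (iota G).
Proof.
split=> [[sH iH]|[iota ->]].
  by exists (generated_counital H); exact: Im_generated_counital.
by split; [exact: subgroup_range | exact: Im_counital_invariant].
Qed.

(* Equality in [characteristic] comes from applying invariance to the inverse. *)
Lemma characteristic_invariant (G : groupType) (H : set G) :
  characteristic H <-> @invariant Grp_iso (Grp_iso_ob G) H.
Proof.
split=> [cH [f bf] x|iH phi bphi]; first by rewrite [_ @` _]cH.
apply/seteqP; split; first exact: (iH (exist _ (phi : grp_hom G G) bphi)).
have [psi phiK psiK] := bphi.
pose psiM := isMultiplicative.Build _ _ psi (can2_gmulfM phiK psiK).
pose psi' : {multiplicative G -> G} := HB.pack psi psiM.
have bpsi : is_grp_iso (psi' : hom (G : Grp) G) by exists phi.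
move=> x Hx; exists (psi x); last exact: psiK.
by apply: (iH (exist _ (psi' : grp_hom G G) bpsi)); exists x.
Qed.

Lemma fully_invariant_invariant (G : groupType) (H : set G) :
  fully_invariant H <-> @invariant (whole Grp) (Grp_ob G) H.
Proof.
split=> [fH f|iH psi]; first exact: fH.
exact: (iH (exist _ (psi : grp_hom G G) I)).
Qed.

Local Close Scope group_scope.

Theorem theorem1 (G : groupType) :
  [set H : set G | subgroup H /\ characteristic H]
    = [set H : set G |
        exists iota : counital Grp_iso, H = Im (iota (Grp_iso_ob G))]
  /\
  [set H : set G | subgroup H /\ fully_invariant H]
    = [set H : set G |
        exists iota : counital (whole Grp), H = Im (iota (Grp_ob G))].
Proof.
split; apply/funext => H /=; apply/propext.
  by rewrite characteristic_invariant; exact: (@Im_counitalP _ (Grp_iso_ob G)).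
by rewrite fully_invariant_invariant; exact: (@Im_counitalP _ (Grp_ob G)).
Qed.
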